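(* If $G$ is a co-comparability graph with at least two vertices, then $\mathrm{thin}(G)\leq |V(G)|/2$.
   Context: Graphs are finite, simple, undirected. A graph $H$ is a comparability graph if there is an ordering $v_1,\dots,v_n$ of $V(H)$ such that for each $r<s<t$, if $v_rv_s$ and $v_sv_t$ are edges then $v_rv_t$ is an edge; $G$ is a co-comparability graph if its complement is a comparability graph. For a graph $G=(V,E)$, an ordering $v_1,\dots,v_n$ of $V$ and a partition of $V$ are consistent if for every $r<s<t$, whenever $v_r,v_s$ are in the same class and $v_tv_r\in E$, then $v_tv_s\in E$. $\mathrm{thin}(G)$ is the minimum number of classes of a partition of $V$ consistent with some ordering of $V$. *)

(* Defs.v *)
From mathcomp Require Import all_boot all_order all_algebra.

Set Implicit Arguments.
Unset Strict Implicit.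
Unset Printing Implicit Defensive.

Record sgraph := SGraph {
  vertex :> finType;
  edge : rel vertex;
  edge_sym : symmetric edge;
  edge_irrefl : irreflexive edge
}.

Section Complement.
Variable G : sgraph.

Definition compl_edge : rel G := fun x y => (x != y) && ~~ edge x y.

Lemma compl_edge_sym : symmetric compl_edge.
Proof. by move=> x y; rewrite /compl_edge eq_sym edge_sym. Qed.

Lemma compl_edge_irrefl : irreflexive compl_edge.
Proof. by move=> x; rewrite /compl_edge eqxx. Qed.

Definition compl : sgraph := SGraph compl_edge_sym compl_edge_irrefl.

End Complement.

Section Thinness.
Variable G : sgraph.

(* An ordering v_1, ..., v_n of V(G) is an injective v : 'I_#|G| -> G; it is
   bijective by cardinality.  Indices start at 0. *)
Definition is_ordering (v : {ffun 'I_#|G| -> G}) : bool := injectiveb v.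

Definition comparability : bool :=
  [exists v : {ffun 'I_#|G| -> G}, is_ordering v &&
    [forall r : 'I_#|G|, forall s : 'I_#|G|, forall t : 'I_#|G|,
      [&& r < s, s < t, edge (v r) (v s) & edge (v s) (v t)]
        ==> edge (v r) (v t)]].

Definition same_class (P : {set {set G}}) (x y : G) : bool :=
  [exists C in P, (x \in C) && (y \in C)].

Definition consistent (v : {ffun 'I_#|G| -> G}) (P : {set {set G}}) : bool :=
  [forall r : 'I_#|G|, forall s : 'I_#|G|, forall t : 'I_#|G|,
    [&& r < s, s < t, same_class P (v r) (v s) & edge (v t) (v r)]
      ==> edge (v t) (v s)].

Definition thin_with (k : nat) : bool :=
  [exists v : {ffun 'I_#|G| -> G}, exists P : {set {set G}},
    [&& is_ordering v, partition P [set: G], consistent v P & #|P| == k]].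

Lemma thin_with_ex : exists k, thin_with k.
Proof.
pose P := preim_partition (@id G) [set: G].
have partP : partition P [set: G] by apply: preim_partitionP.
exists #|P|; apply/existsP; exists [ffun i => enum_val i].
apply/existsP; exists P; rewrite partP eqxx andbT /=.
have inj_v : injective [ffun i : 'I_#|G| => enum_val i : G].
  by move=> i j; rewrite !ffunE => /enum_val_inj.
apply/andP; split; first exact/injectiveP.
apply/forallP=> r; apply/forallP=> s; apply/forallP=> t; apply/implyP.
case/and4P=> lt_rs _ /exists_inP[C /imsetP[z _ ->]].
rewrite !inE => /andP[/eqP zr /eqP zs] _; move: lt_rs.
by rewrite (inj_v _ _ (etrans (esym zr) zs)) ltnn.
Qed.

Definition thin : nat := ex_minn thin_with_ex.

End Thinness.

Definition co_comparability (G : sgraph) : bool := comparability (compl G).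

(* Main.v *)
(** Two bounds on the thinness are combined.

    If [K] is a clique missing some vertex [s], order the vertices as
    [V \ (K + s)], then [s], then [K]; the partition into [K + s] and
    singletons is consistent, because the last two vertices of any triple
    starting in [K + s] lie in [K].  Hence [thin G <= n - #|K|].

    If [G] is a co-comparability graph, its non-edges form a strict partial
    order compatible with the given vertex ordering, and any partition into
    chains (independent sets of [G]) is consistent with that ordering.  By
    Dilworth's theorem, some clique [K] of [G] satisfies [thin G <= #|K|].

    One of [n - #|K|] and [#|K|] is at most [n / 2].  If [K] is the whole of
    [V], the first bound for [K] minus one vertex gives [thin G <= 1]. *)
Require Import Defs.
From mathcomp Require Import all_boot all_order all_algebra.
From mathcomp Require Import zify.
Import Num.Theory GRing.Theory.
Local Open Scope ring_scope.

Section FiniteTypes.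
Local Set Implicit Arguments.
Local Unset Strict Implicit.
Local Open Scope nat_scope.

Lemma partition_set1 (T : finType) (D : {set T}) : partition (set1 @: D) D.
Proof.
suff -> : set1 @: D = preim_partition id D by exact: preim_partitionP.
apply: eq_in_imset => x xD; apply/setP => y; rewrite !inE eq_sym.
by case: eqVneq => [<-|]; rewrite ?xD ?andbF.
Qed.

Definition block_and_singletons (T : finType) (A : {set T}) : {set {set T}} :=
  A |: set1 @: ~: A.

Lemma block_and_singletons_partition (T : finType) (A : {set T}) :
  A != set0 -> partition (block_and_singletons A) [set: T].
Proof.
move=> A0; rewrite -(setUCr A); apply: partitionU1 => //.
  exact: partition_set1.
by rewrite disjoints_subset setCK.
Qed.

Lemma card_block_and_singletons (T : finType) (A : {set T}) :
  #|block_and_singletons A| <= #|~: A|.+1.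
Proof.
rewrite cardsU1 card_imset; last exact: set1_inj.
by rewrite -add1n leq_add2r; case: (_ \in _).
Qed.

Lemma exists_sorted_ordering (T : finType) (leT : rel T) :
    total leT -> transitive leT ->
  exists2 v : {ffun 'I_#|T| -> T}, injective v &
    {homo v : i j / i < j >-> leT i j}.
Proof.
move=> leT_total leT_trans; pose e := sort_tuple leT (enum_tuple T).
exists [ffun i => tnth e i] => [i j | i j ltij]; rewrite !ffunE.
  by apply/tuple_uniqP; rewrite sort_uniq enum_uniq.
rewrite (tnth_nth (enum_val i)) (tnth_nth (enum_val i) e j).
apply: (sorted_ltn_nth leT_trans) => //; rewrite ?inE ?size_tuple //.
exact: sort_sorted.
Qed.

End FiniteTypes.

Section Dilworth.
Local Set Implicit Arguments.
Local Unset Strict Implicit.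
Local Open Scope nat_scope.
Variables (T : finType) (lt : rel T).
Hypotheses (lt_irr : irreflexive lt) (lt_trans : transitive lt).
Implicit Types (A C K Q X : {set T}) (P : {set {set T}}) (x y : T).

Definition chain C : bool :=
  [forall x in C, forall y in C, [|| x == y, lt x y | lt y x]].

Definition antichain Q : bool := [forall x in Q, forall y in Q, ~~ lt x y].

Definition maximals A : {set T} := [set x in A | [forall y in A, ~~ lt x y]].

Definition segment C x : {set T} := [set z in C | (z == x) || lt z x].

Definition chain_partition P A : bool :=
  partition P A && [forall C in P, chain C].

Definition antichain_transversal Q P A : bool :=
  antichain Q && is_transversal Q P A.

Definition top_antichain_transversal X P A : Prop :=
  antichain_transversal X P A /\
  forall Q C x, antichain_transversal Q P A -> C \in P ->
    x \in X :&: C -> Q :&: C \subset segment C x.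

Lemma chainP C :
  reflect {in C &, forall x y, [|| x == y, lt x y | lt y x]} (chain C).
Proof.
apply: (iffP forall_inP) => [chC x y xC yC | chC x xC].
  exact: (forall_inP (chC x xC)).
by apply/forall_inP => y yC; exact: chC.
Qed.

Lemma antichainP Q : reflect {in Q &, forall x y, ~~ lt x y} (antichain Q).
Proof.
apply: (iffP forall_inP) => [aQ x y xQ yQ | aQ x xQ].
  exact: (forall_inP (aQ x xQ)).
by apply/forall_inP => y yQ; exact: aQ.
Qed.

Lemma maximalsP A x :
  reflect (x \in A /\ {in A, forall y, ~~ lt x y}) (x \in maximals A).
Proof.
rewrite inE; apply: (iffP andP) => -[xA xmax]; split=> //; exact/forall_inP.
Qed.

Lemma maximals_antichain A : antichain (maximals A).
Proof.
by apply/antichainP => x y /maximalsP[_ xmax] /maximalsP[yA _]; exact: xmax.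
Qed.

Lemma maximals_neq0 A : A != set0 -> maximals A != set0.
Proof.
case/set0Pn => x0 x0A; pose above x := [set y in A | lt x y].
case: (arg_minnP (fun x => #|above x|) x0A) => x xA xmin.
apply/set0Pn; exists x; apply/maximalsP; split=> // y yA; apply/negP => ltxy.
have := xmin y yA; rewrite leqNgt => /negP; apply.
apply: proper_card; apply/properP; split.
  by apply/subsetP => z; rewrite !inE => /andP[-> /(lt_trans ltxy)].
by exists y; rewrite !inE yA ?ltxy ?lt_irr.
Qed.

Lemma chain1 x : chain [set x].
Proof. by apply/chainP => y z /set1P-> /set1P->; rewrite eqxx. Qed.

Lemma chainU1_segment C a x :
  chain C -> lt x a -> chain (a |: segment C x).
Proof.
move=> /chainP chC ltxa.
have below_a z : (z == x) || lt z x -> lt z a.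
  by case/orP => [/eqP->|/lt_trans->].
apply/chainP => y z; rewrite !inE.
move=> /orP[/eqP->|/andP[yC ley]] /orP[/eqP->|/andP[zC lez]].
- by rewrite eqxx.
- by rewrite (below_a z lez) !orbT.
- by rewrite (below_a y ley) orbT.
- exact: chC.
Qed.

Lemma antichainU1 A X a :
    a \in maximals A -> X \subset A -> antichain X ->
    {in X, forall x, ~~ lt x a} ->
  antichain (a |: X).
Proof.
move=> /maximalsP[_ amax] /subsetP sXA /antichainP aX nXa.
apply/antichainP => x y /setU1P[->|xX] /setU1P[->|yX].
- by rewrite lt_irr.
- by apply: amax; exact: sXA.
- exact: nXa.
- exact: aX.
Qed.

Lemma card_antichainI_chain Q C : antichain Q -> chain C -> #|Q :&: C| <= 1.
Proof.
move=> /antichainP aQ /chainP chC; apply/card_le1_eqP => y x.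
rewrite !inE => /andP[yQ yC] /andP[xQ xC]; apply/eqP; have := chC x y xC yC.
by rewrite (negPf (aQ x y _ _)) // (negPf (aQ y x _ _)) // !orbF.
Qed.

Lemma chain_partition_chain P A C : chain_partition P A -> C \in P -> chain C.
Proof. by case/andP => _ /forall_inP; apply. Qed.

Lemma chain_partition_sub P A C : chain_partition P A -> C \in P -> C \subset A.
Proof. by case/andP => partP _; exact: partitionS partP. Qed.

Lemma chain_partition0 : chain_partition set0 set0.
Proof.
rewrite /chain_partition partition_set0 eqxx.
by apply/forall_inP => C; rewrite inE.
Qed.

Lemma chain_partitionU1 P A K :
    chain K -> K != set0 -> K \subset A -> chain_partition P (A :\: K) ->
  chain_partition (K |: P) A.
Proof.
move=> chK K0 sKA /andP[partP /forall_inP chP]; apply/andP; split.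
  rewrite -(setID A K) (setIidPr sKA); apply: partitionU1 => //.
  by rewrite disjoint_sym disjoints_subset setDE subsetIr.
by apply/forall_inP => C /setU1P[->|/chP].
Qed.

Lemma antichain_transversal_sub P A Q :
  antichain_transversal Q P A -> Q \subset A.
Proof. by case/andP => _; exact: transversal_sub. Qed.

Lemma card_antichain_transversal P A Q :
  antichain_transversal Q P A -> #|Q| = #|P|.
Proof. by case/andP => _; exact: card_transversal. Qed.

Lemma antichain_transversal_meets P A Q C :
  antichain_transversal Q P A -> C \in P -> Q :&: C != set0.
Proof.
case/andP => _ /and3P[_ _ /forall_inP trQ] /trQ/eqP cQC.
by rewrite -card_gt0 cQC.
Qed.

Lemma antichain_transversal_of_meets P A Q :
    chain_partition P A -> antichain Q -> Q \subset A ->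
    {in P, forall C, Q :&: C != set0} ->
  antichain_transversal Q P A.
Proof.
move=> chP aQ sQA meetQ; have /andP[partP _] := chP.
apply/andP; split=> //; apply/and3P; split=> //.
apply/forall_inP => C CP.
have chC := chain_partition_chain chP CP.
by rewrite eqn_leq card_gt0 meetQ // card_antichainI_chain.
Qed.

Lemma antichain_transversal_of_card P A Q :
    chain_partition P A -> antichain Q -> Q \subset A -> #|P| <= #|Q| ->
  antichain_transversal Q P A.
Proof.
move=> chP aQ sQA lePQ; apply: antichain_transversal_of_meets => //.
have /andP[partP _] := chP; apply: (partition_pigeonhole partP) => // C CP.
have chC := chain_partition_chain chP CP; exact: card_antichainI_chain.
Qed.

(* The antichain transversals of a chain partition form a lattice; its greatest
   element consists of the maximal elements of their union. *)
Lemma exists_top_antichain_transversal P A Q0 :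
    chain_partition P A -> antichain_transversal Q0 P A ->
  exists X, top_antichain_transversal X P A.
Proof.
move=> chP trQ0; pose U := \bigcup_(Q | antichain_transversal Q P A) Q.
have mem_U Q x : antichain_transversal Q P A -> x \in Q -> x \in U.
  by move=> trQ xQ; apply/bigcupP; exists Q.
have sUA : U \subset A.
  by apply/bigcupsP => Q; exact: antichain_transversal_sub.
exists (maximals U); split; last first.
  move=> Q C x trQ CP /setIP[/maximalsP[_ xmax] xC].
  apply/subsetP => y /setIP[yQ yC]; rewrite inE yC.
  have /chainP chC := chain_partition_chain chP CP.
  by have := chC y x yC xC; rewrite (negPf (xmax y _)) ?orbF // (mem_U Q).
apply: antichain_transversal_of_meets => //; first exact: maximals_antichain.
  by apply: subset_trans sUA; apply/subsetP => x /maximalsP[].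
move=> C CP; have /chainP chC := chain_partition_chain chP CP.
have /maximals_neq0/set0Pn[m /maximalsP[/setIP[mU mC] mmax]] :
    U :&: C != set0.
  have /set0Pn[x /setIP[xQ0 xC]] := antichain_transversal_meets trQ0 CP.
  by apply/set0Pn; exists x; rewrite inE xC (mem_U Q0).
apply/set0Pn; exists m; rewrite inE mC andbT; apply/maximalsP; split=> // u.
case/bigcupP => Q trQ uQ; apply/negP => ltmu.
have /set0Pn[y /setIP[yQ yC]] := antichain_transversal_meets trQ CP.
have leym : (y == m) || lt y m.
  have := mmax y; rewrite inE yC (mem_U Q) // => /(_ isT) /negPf nmy.
  by have := chC y m yC mC; rewrite nmy orbF.
have /andP[/antichainP aQ _] := trQ.
by have /negP[] := aQ y u yQ uQ; case/orP: leym => [/eqP->|/lt_trans->].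
Qed.

Lemma card_antichain_avoiding_segment P A X C x Q :
    chain_partition P A -> top_antichain_transversal X P A ->
    C \in P -> x \in X :&: C -> antichain Q -> Q \subset A :\: segment C x ->
  #|Q| < #|P|.
Proof.
move=> chP [_ topX] CP xXC aQ; rewrite subsetD => /andP[sQA disjQ].
rewrite ltnNge; apply/negP => lePQ.
have trQ := antichain_transversal_of_card chP aQ sQA lePQ.
have /set0Pn[y yQC] := antichain_transversal_meets trQ CP.
have ySx := subsetP (topX Q C x trQ CP xXC) y yQC.
by case/setIP: yQC => /(disjointFr disjQ); rewrite ySx.
Qed.

Lemma leq_card_antichain P A Q :
  chain_partition P A -> antichain Q -> Q \subset A -> #|Q| <= #|P|.
Proof.
move=> chP aQ sQA; rewrite leqNgt; apply/negP => ltPQ.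
have trQ := antichain_transversal_of_card chP aQ sQA (ltnW ltPQ).
by rewrite (card_antichain_transversal trQ) ltnn in ltPQ.
Qed.

(* Let [X] be the top antichain transversal of the chain partition of [A :\ a].
   If no element of [X] lies below [a], then [a |: X] is an antichain and
   [K = [set a]] works; if [x < a] for some [x] in [X], then [K] consists of [a]
   and the segment of [x] in its chain. *)
Lemma galvin_chain P A Q a :
    a \in maximals A -> chain_partition P (A :\ a) ->
    antichain_transversal Q P (A :\ a) ->
  exists K X, [/\ a \in K, chain K & K \subset A] /\
    [/\ antichain X, X \subset A &
      forall Q', antichain Q' -> Q' \subset A :\: K -> #|Q'| < #|X|].
Proof.
move=> amax chP trQ; have [aA _] := maximalsP _ _ amax.
have [X topX] := exists_top_antichain_transversal chP trQ.
have [trX _] := topX; have /andP[aX _] := trX.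
have sX := antichain_transversal_sub trX.
have sXA : X \subset A := subset_trans sX (subsetDl _ _).
have [/exists_inP[x xX ltxa]|/exists_inPn nXa] := boolP [exists x in X, lt x a].
  have /bigcupP[C CP xC] : x \in cover P.
    by have /andP[/cover_partition-> _] := chP; exact: (subsetP sX).
  exists (a |: segment C x), X; split; split=> //.
  - exact: setU11.
  - exact: chainU1_segment (chain_partition_chain chP CP) ltxa.
  - rewrite subUset sub1set aA; apply: subset_trans (subsetDl A [set a]).
    apply: subset_trans (chain_partition_sub chP CP).
    by rewrite /segment setIdE subsetIl.
  - move=> Q' aQ'; rewrite -setDDl (card_antichain_transversal trX).
    have xXC : x \in X :&: C by rewrite inE xX.
    exact: (card_antichain_avoiding_segment chP topX CP xXC aQ').
exists [set a], (a |: X); split; split; rewrite ?set11 ?chain1 ?sub1set //.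
- exact: antichainU1 amax sXA aX nXa.
- by rewrite subUset sub1set aA.
- move=> Q' aQ' sQ'; have aNX : a \notin X.
    by apply/negP => /(subsetP sX); rewrite setD11.
  rewrite cardsU1 aNX ltnS (card_antichain_transversal trX).
  exact: leq_card_antichain chP aQ' sQ'.
Qed.

Theorem dilworth A :
  exists P Q, chain_partition P A /\ antichain_transversal Q P A.
Proof.
have [n leAn] := ubnP #|A|; elim: n A leAn => // n IHn A leAn.
have [->|/maximals_neq0/set0Pn[a amax]] := eqVneq A set0.
  exists set0, set0; have ch0 := chain_partition0; split=> //.
  apply: antichain_transversal_of_card; rewrite ?sub0set ?cards0 //.
  by apply/antichainP => x y; rewrite inE.
have [aA _] := maximalsP _ _ amax.
have dilworth_setD K : a \in K -> exists P Q,
    chain_partition P (A :\: K) /\ antichain_transversal Q P (A :\: K).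
  move=> aK; apply: IHn; rewrite -ltnS (leq_trans _ leAn) // ltnS.
  apply: proper_card; apply/properP; split; first exact: subsetDl.
  by exists a; rewrite ?inE ?aK.
have [P [Q [chP trQ]]] := dilworth_setD [set a] (set11 a).
have [K [X [[aK chK sKA] [aX sXA ltX]]]] := galvin_chain amax chP trQ.
have [P' [Q' [chP' trQ']]] := dilworth_setD K aK; have /andP[aQ' _] := trQ'.
have chKP' : chain_partition (K |: P') A.
  by apply: chain_partitionU1 => //; apply/set0Pn; exists a.
exists (K |: P'), X; split=> //; apply: antichain_transversal_of_card => //.
have := ltX Q' aQ' (antichain_transversal_sub trQ').
rewrite (card_antichain_transversal trQ'); apply: leq_trans.
by rewrite cardsU1; case: (K \in P').
Qed.

End Dilworth.

Section ThinBounds.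
Local Set Implicit Arguments.
Local Unset Strict Implicit.
Local Open Scope nat_scope.
Variable G : sgraph.
Implicit Types (v : {ffun 'I_#|G| -> G}) (P : {set {set G}}) (K : {set G}).
Implicit Types (w : G -> 'I_#|G|) (x y z : G).

Definition clique K : Prop := {in K &, forall x y, x != y -> edge x y}.

Lemma same_classP P x y :
  reflect (exists2 C, C \in P & x \in C /\ y \in C) (same_class P x y).
Proof. by apply: (iffP exists_inP) => -[C CP /andP]; exists C. Qed.

Lemma consistentP v P :
  reflect (forall r s t : 'I_#|G|, r < s -> s < t ->
             same_class P (v r) (v s) -> edge (v t) (v r) -> edge (v t) (v s))
          (consistent v P).
Proof.
apply: (iffP idP) => [consP r s t rs st Prs etr | consP].
  have /forallP/(_ s)/forallP/(_ t)/implyP := forallP consP r.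
  by apply; rewrite rs st Prs.
apply/forallP => r; apply/forallP => s; apply/forallP => t; apply/implyP.
by case/and4P; exact: consP.
Qed.

Lemma thin_le_card_partition v P :
    injective v -> partition P [set: G] -> consistent v P ->
  thin G <= #|P|.
Proof.
move=> v_inj partP consP; rewrite /thin; case: ex_minnP => k _; apply.
apply/existsP; exists v; apply/existsP; exists P.
by rewrite partP consP eqxx !andbT; exact/injectiveP.
Qed.

Lemma same_class_block_and_singletons (A : {set G}) x y :
    x != y -> same_class (block_and_singletons A) x y ->
  x \in A /\ y \in A.
Proof.
move=> neq_xy /same_classP[C /setU1P[->//|/imsetP[z _ ->]]].
by case=> /set1P xz /set1P yz; rewrite xz yz eqxx in neq_xy.
Qed.

Lemma thin_le_cardC_clique K s : clique K -> s \notin K -> thin G <= #|~: K|.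
Proof.
move=> clK sK; pose rank x := (x \in s |: K) + (x \in K).
have [||v v_inj v_mono] := @exists_sorted_ordering G (relpre rank leq).
- by move=> x y; exact: leq_total.
- by move=> x y z; exact: leq_trans.
have v_neq (i j : 'I_#|G|) : i < j -> v i != v j.
  by move=> ltij; rewrite (inj_eq v_inj) neq_ltn ltij.
have cardP : #|block_and_singletons (s |: K)| <= #|~: K|.
  apply: leq_trans (card_block_and_singletons _) _.
  have -> : ~: (s |: K) = ~: K :\ s by apply/setP => x; rewrite !inE negb_or.
  by rewrite [leqRHS](cardsD1 s) inE sK.
apply: leq_trans cardP; apply: (thin_le_card_partition v_inj).
  apply: block_and_singletons_partition.
  by apply/set0Pn; exists s; rewrite setU11.
apply/consistentP => a b t ab bt.
case/(same_class_block_and_singletons (v_neq a b ab)) => a_sK b_sK _.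
have bK : v b \in K.
  have := v_mono a b ab; rewrite /= /rank a_sK b_sK leq_add2l.
  case/setU1P: b_sK => // eq_bs; case/setU1P: a_sK => [eq_as|->].
    by have /eqP[] := v_neq a b ab; rewrite eq_as eq_bs.
  by case: (v b \in K).
have tK : v t \in K.
  have := v_mono b t bt; rewrite /= /rank b_sK bK.
  by case: (v t \in K) => //; case: (v t \in s |: K).
by apply: clK => //; rewrite eq_sym v_neq.
Qed.

Lemma thin_le_maxn_cardC_clique K :
  0 < #|G| -> clique K -> thin G <= maxn 1 #|~: K|.
Proof.
case/card_gt0P => x _ clK.
have [KT|/subsetPn[s _ sK]] := boolP ([set: G] \subset K).
  have clKx : clique (K :\ x).
    by move=> y z /setD1P[_ yK] /setD1P[_ zK]; exact: clK.
  have := thin_le_cardC_clique clKx (negbT (setD11 x K)).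
  move: KT; rewrite subTset => /eqP->; rewrite setTD setCK cards1 => thin1.
  exact: leq_trans thin1 (leq_maxl _ _).
exact: leq_trans (thin_le_cardC_clique clK sK) (leq_maxr _ _).
Qed.

Definition precedes_nonadjacent w : rel G :=
  fun x y => (w x < w y) && ~~ edge x y.

Lemma precedes_nonadjacent_irr w : irreflexive (precedes_nonadjacent w).
Proof. by move=> x; rewrite /precedes_nonadjacent ltnn. Qed.

Lemma co_comparability_ordering :
  co_comparability G -> exists v w,
    [/\ cancel v w, cancel w v & transitive (precedes_nonadjacent w)].
Proof.
case/existsP => v /andP[/injectiveP v_inj cmp].
have [w vK wK] : bijective v by apply: inj_card_bij; rewrite ?card_ord.
exists v, w; split=> // y x z /andP[ltxy exy] /andP[ltyz eyz].
have neq_w x' y' : w x' < w y' -> x' != y'.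
  by apply: contraTneq => ->; rewrite ltnn.
have /forallP/(_ (w y))/forallP/(_ (w z))/implyP := forallP cmp (w x).
rewrite !wK ltxy ltyz /= /compl_edge (neq_w x y) // (neq_w y z) // exy eyz.
case/(_ isT)/andP => _ exz.
by rewrite /precedes_nonadjacent exz (ltn_trans ltxy).
Qed.

Lemma antichain_clique w K :
  injective w -> antichain (precedes_nonadjacent w) K -> clique K.
Proof.
move=> w_inj /antichainP aK x y xK yK; rewrite -(inj_eq w_inj) neq_ltn.
case/orP => lt_w; [have := aK x y xK yK | have := aK y x yK xK].
  by rewrite negb_and lt_w negbK.
by rewrite negb_and lt_w negbK edge_sym.
Qed.

Lemma chain_partition_consistent v w P :
    cancel v w -> transitive (precedes_nonadjacent w) ->
    chain_partition (precedes_nonadjacent w) P [set: G] ->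
  consistent v P.
Proof.
move=> vK prec_trans chP; apply/consistentP => r s t rs st.
case/same_classP => C CP [rC sC].
have prec_rs : precedes_nonadjacent w (v r) (v s).
  have /chainP/(_ _ _ rC sC) := chain_partition_chain chP CP.
  rewrite (inj_eq (can_inj vK)) -val_eqE ltn_eqF //.
  by rewrite /precedes_nonadjacent !vK (ltnNge s) (ltnW rs) orbF.
apply: contraLR => nts; have prec_st : precedes_nonadjacent w (v s) (v t).
  by rewrite /precedes_nonadjacent !vK st edge_sym.
by have /andP[_] := prec_trans _ _ _ prec_rs prec_st; rewrite edge_sym.
Qed.

Lemma co_comparability_thin_le_clique :
  co_comparability G -> exists2 K, clique K & thin G <= #|K|.
Proof.
case/co_comparability_ordering => v [w [vK wK prec_trans]].
have [P [Q [chP trQ]]] :=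
  dilworth (@precedes_nonadjacent_irr w) prec_trans [set: G].
have [aQ _] := andP trQ; have [partP _] := andP chP.
exists Q; first exact: antichain_clique (can_inj wK) aQ.
rewrite (card_antichain_transversal trQ).
apply: (thin_le_card_partition (can_inj vK) partP).
exact: chain_partition_consistent vK prec_trans chP.
Qed.

End ThinBounds.

Theorem theorem3p21 (G : sgraph)
  (hG : co_comparability G) (hcard : (2 <= #|G|)%N) :
  (thin G)%:R <= (#|G|%:R / 2%:R :> rat).
Proof.
rewrite ler_pdivlMr // -natrM ler_nat.
have [K clK le_thin_K] := co_comparability_thin_le_clique hG.
have := thin_le_maxn_cardC_clique (ltnW hcard) clK.
by have := cardsC K; lia.
Qed.
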